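(* Let $n\ge 1$. The number of permutations in $S_n$ which have exactly $n$ different separators is $2^k\,k!$ if $n=4k$ for some positive integer $k$, and $0$ otherwise.
   Context: Permutations $\sigma\in S_n$ are written in one-line notation $\sigma=[\sigma_1,\dots,\sigma_n]$. The digit $\sigma_i$ is a vertical separator of $\sigma$ if $1<i<n$ and $|\sigma_{i-1}-\sigma_{i+1}|=1$. The digit $\sigma_i=a$ is a horizontal separator of $\sigma$ if $1<a<n$ and the values $a-1$ and $a+1$ occupy adjacent positions in $\sigma$, i.e. $|\sigma^{-1}(a-1)-\sigma^{-1}(a+1)|=1$. A digit is a separator of $\sigma$ if it is a vertical separator or a horizontal separator (or both); a digit that is of both types is counted once. *)

(* Defs.v *)
From mathcomp Require Import all_boot all_order all_algebra all_fingroup.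
Import IntDist.

Set Implicit Arguments.
Unset Strict Implicit.
Unset Printing Implicit Defensive.

(* Positions and values are elements of 'I_n, hence numbered from 0; every     *)
(* condition below is invariant under the shift to {1, ..., n}. A digit is     *)
(* identified with its value a, so its position in s is s^-1 a, and the        *)
(* interiority conditions 1 < i < n and 1 < a < n amount to the existence      *)
(* of the two neighbours in 'I_n.                                              *)

Definition vertical_separator n (s : 'S_n) (a : 'I_n) : bool :=
  [exists i : 'I_n, exists j : 'I_n, exists k : 'I_n,
    [&& s j == a, i.+1 == j :> nat, k == j.+1 :> nat
      & `|s i - s k|%N == 1%N]].

Definition horizontal_separator n (s : 'S_n) (a : 'I_n) : bool :=
  [exists b : 'I_n, exists c : 'I_n,
    [&& b.+1 == a :> nat, c == a.+1 :> nat
      & `|(s^-1)%g b - (s^-1)%g c|%N == 1%N]].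

Definition separators n (s : 'S_n) : {set 'I_n} :=
  [set a | vertical_separator s a || horizontal_separator s a].

(* Main.v *)
Require Import Defs.
From mathcomp Require Import all_boot all_order all_algebra all_fingroup.
From mathcomp Require Import zify.

(* A vertical (horizontal) separator lies in the column (row) between two     *)
(* points of the permutation diagram that are a knight's move apart. Suppose  *)
(* that every point is a separator. Following what separates each point, a    *)
(* wedge (2,1,3,0) or a monotone chain (0,x,1,x+1,2) would force a further    *)
(* point extending it, hence grow forever; ruling these out, the immediate    *)
(* surroundings of any vertical separator form a box: four points in          *)
(* consecutive rows and columns with pattern 2413 or 3142. Exchanging rows    *)
(* and columns, every point lies in a box. Two overlapping boxes coincide, so *)
(* the boxes tile the diagram: the permutation is the inflation of a          *)
(* permutation of S_k by k patterns chosen freely among 2413 and 3142.        *)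

(** The local result is [col_sep_box], resting on [no_wedge] and [no_chain], where forced extensions
    would leave every bounded region. Tiling starts at column 0, which must open a box; since boxes
    sharing a column coincide ([box_overlap]), boxes open exactly at the multiples of 4, for rows as
    for columns ([tiling]). The last box has to fit, so 4 divides n. Conversely, every point of a
    box is separated inside that box ([box_sep]), so [inflate] is a bijection from the 2^k k!
    choices of a block permutation and k patterns onto the permutations counted. *)

Import GRing.Theory.
Local Open Scope ring_scope.

(* A permutation is handled as the set of its points (column, row), a relation*)
(* over the integers: rows and columns play symmetric roles, and no boundary  *)
(* cases arise.                                                               *)
Definition transpose (P : int -> int -> Prop) : int -> int -> Prop :=
  fun x y => P y x.

(** A condition on the column alone, so that separation by rows is the same predicate for
    [transpose P], taken at the row. *)
Definition col_sep (P : int -> int -> Prop) (x : int) : Prop :=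
  exists z e : int, [/\ e = 1 \/ e = -1, P (x - 1) z & P (x + 1) (z + e)].

Record saturated (P : int -> int -> Prop) : Prop := Saturated {
  sat_rook : forall x y x' y', P x y -> P x' y' -> (x = x' <-> y = y');
  sat_bound : exists N : int,
    forall x y, P x y -> (`|x| <= N) /\ (`|y| <= N);
  sat_sep : forall x y, P x y -> col_sep P x \/ col_sep (transpose P) y }.

Lemma saturatedT P : saturated P -> saturated (transpose P).
Proof.
case=> rook [N bound] sep; split=> [x y x' y' Pxy Px'y'||x y Pxy].
- by split=> /(rook _ _ _ _ Pxy Px'y').
- by exists N => x y /bound[].
- by case: (sep _ _ Pxy) => ?; [right | left].
Qed.

Lemma rel_eq (P : int -> int -> Prop) x y x' y' :
  P x y -> x = x' -> y = y' -> P x' y'.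
Proof. by move=> Pxy <- <-. Qed.

Lemma col_sep_step P (x d z : int) : saturated P -> d = 1 \/ d = -1 ->
  col_sep P x -> P (x - d) z -> P (x + d) (z + 1) \/ P (x + d) (z - 1).
Proof.
move=> satP dE [w [e [eE Q1 Q2]]] Pz; have rook := sat_rook P satP.
case: dE => ?; subst d.
  have ? : w = z by have := rook _ _ _ _ Q1 Pz; lia.
  by subst w; case: eE => ?; subst e; [left|right].
have ? : z = w + e by have := rook _ _ _ _ Q2 Pz; lia.
by subst z; case: eE => ?; subst e; [right|left]; apply: rel_eq Q1 _ _; lia.
Qed.

(* If the point (x, y) is separated by its columns, the point of column [x - d] *)
(* forces one in column [x + d]; if by its rows, that of row [y - d'] forces one *)
(* in row [y + d'].                                                              *)
Lemma sat_sep_step P (x y d z d' u : int) : saturated P ->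
  d = 1 \/ d = -1 -> d' = 1 \/ d' = -1 ->
  P x y -> P (x - d) z -> P u (y - d') ->
  (P (x + d) (z + 1) \/ P (x + d) (z - 1)) \/
  (P (u + 1) (y + d') \/ P (u - 1) (y + d')).
Proof.
move=> satP dE d'E Pxy Pz Pu; case: (sat_sep P satP x y Pxy) => sep.
  by left; apply: col_sep_step sep Pz.
by right; apply: (col_sep_step (transpose P) y d' u (saturatedT P satP)).
Qed.

(** * Configurations that would grow forever *)

(** The zigzag widens in direction [d]. Its last point can only be separated by columns, which
    forces a fifth point; dropping the first point leaves a wedge with [e] negated. The induction is
    on the distance to the boundary in direction [d]. *)
Lemma no_wedge P (p a b d e : int) : saturated P ->
  d = 1 \/ d = -1 -> e = 1 \/ e = -1 -> 0 < e * (a - b) ->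
  P p a -> P (p + d) b -> P (p + 2 * d) (a + e) -> P (p + 3 * d) (b - e) ->
  False.
Proof.
move=> satP dE; have [N bound] := sat_bound P satP.
have rook := sat_rook P satP.
have [m Nm] : exists m : nat, N - d * p < m%:Z.
  by exists (absz (N - d * p)%R).+1; lia.
elim: m p a b e Nm => [|m IHm] p a b e Nm eE ab P0 P1 P2 P3.
  by have [] := bound _ _ P0; case: dE => ?; subst d; lia.
have {}ab : e = 1 /\ b < a \/ e = -1 /\ a < b.
  by case: eE ab => ?; subst e; lia.
suff P4 : P (p + 4 * d) (a + 2 * e).
  apply: (IHm (p + d) b (a + e) (- e)).
  - by case: dE => ?; subst d; lia.
  - lia.
  - by case: eE => ?; subst e; lia.
  - exact: P1.
  - by apply: rel_eq P2 _ _; lia.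
  - by apply: rel_eq P3 _ _; lia.
  - by apply: rel_eq P4 _ _; lia.
have [] : (P (p + 3 * d + d) (a + e + 1) \/ P (p + 3 * d + d) (a + e - 1)) \/
  (P (p + d + 1) (b - e - e) \/ P (p + d - 1) (b - e - e)).
  apply: sat_sep_step P3 _ _ => //; first lia.
    by apply: rel_eq P2 _ _; lia.
  by apply: rel_eq P1 _ _; lia.
- by case=> Q; have := rook _ _ _ _ Q P0;
    move=> ?; apply: rel_eq Q _ _; lia.
(* Separation by rows would put row [b - 2 * e] in the column of [P0] or [P2], both of which lie on
   the other side of [b]. *)
- by case=> Q; have := rook _ _ _ _ Q P0; have := rook _ _ _ _ Q P2; lia.
Qed.

(** If the last point is separated by columns, the two interleaved monotone sequences continue, and
    the chain shifts right with their roles exchanged. If by rows, then [a = c + 3 * e], and nothing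
    can separate the first point. *)
Lemma no_chain P (p a c e : int) : saturated P -> e = 1 \/ e = -1 ->
  P p c -> P (p + 1) a -> P (p + 2) (c + e) -> P (p + 3) (a + e) ->
  P (p + 4) (c + 2 * e) -> False.
Proof.
move=> satP eE; have [N bound] := sat_bound P satP.
have rook := sat_rook P satP.
have [m Nm] : exists m : nat, N - p < m%:Z.
  by exists (absz (N - p)%R).+1; lia.
elim: m p a c Nm => [|m IHm] p a c Nm P0 P1 P2 P3 P4.
  by have [] := bound _ _ P0; lia.
have a_c2 : a <> c + 2 * e by have := rook _ _ _ _ P1 P4; lia.
have [] : (P (p + 4 + 1) (a + e + 1) \/ P (p + 4 + 1) (a + e - 1)) \/
  (P (p + 2 + 1) (c + 2 * e + e) \/ P (p + 2 - 1) (c + 2 * e + e)).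
- apply: sat_sep_step P4 _ _ => //; first by left.
    by apply: rel_eq P3 _ _; lia.
  by apply: rel_eq P2 _ _; lia.
- move=> Q; have {}Q : P (p + 5) (a + 2 * e).
    by case: Q => Q; have := rook _ _ _ _ Q P1; move=> ?;
      apply: rel_eq Q _ _; lia.
  by apply: (IHm (p + 1) (c + e) a); first lia;
    [apply: rel_eq P1 _ _ | apply: rel_eq P2 _ _ | apply: rel_eq P3 _ _
    |apply: rel_eq P4 _ _ | apply: rel_eq Q _ _]; lia.
move=> Q; have {Q} ? : a = c + 3 * e.
  by case: Q => Q; [have := rook _ _ _ _ Q P3 | have := rook _ _ _ _ Q P1]; lia.
subst a.
have [] : (P (p + -1) (c + 3 * e + 1) \/ P (p + -1) (c + 3 * e - 1)) \/
  (P (p + 2 + 1) (c + - e) \/ P (p + 2 - 1) (c + - e)).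
- apply: sat_sep_step P0 _ _ => //; [by right|lia|].
  by apply: rel_eq P2 _ _; lia.
- by case=> Q; have := rook _ _ _ _ Q P3; have := rook _ _ _ _ Q P4; lia.
- by case=> Q; have := rook _ _ _ _ Q P3; have := rook _ _ _ _ Q P1; lia.
Qed.

(* The patterns 2413 ([b = true]) and 3142 ([b = false]), numbered from 0. *)
Definition pattern (b : bool) (t : nat) : nat :=
  nth 0%N (if b then [:: 1; 3; 0; 2] else [:: 2; 0; 3; 1])%N t.

(** * Boxes around separated points *)

Definition box (P : int -> int -> Prop) (p q : int) (b : bool) : Prop :=
  forall t, (t < 4)%N -> P (p + t%:Z) (q + (pattern b t)%:Z).

Lemma box_intro (P : int -> int -> Prop) p q b :
  P p (q + (pattern b 0)%:Z) -> P (p + 1) (q + (pattern b 1)%:Z) ->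
  P (p + 2) (q + (pattern b 2)%:Z) -> P (p + 3) (q + (pattern b 3)%:Z) ->
  box P p q b.
Proof. by move=> P0 P1 P2 P3 [|[|[|[|t]]]] // _; rewrite addr0. Qed.

(** The left and right neighbours must be separated too, each in one of three ways ([Sl], [Sr]). Of
    the nine combinations two give a box, with (x, y) as its third or second point; the others are
    impossible. *)
Lemma col_sep_box P x y : saturated P -> P x y -> col_sep P x ->
  exists p q b, box P p q b /\ (x = p + 1 \/ x = p + 2).
Proof.
move=> satP P0 [a [e [eE Pl Pr]]]; have rook := sat_rook P satP.
have wedge := no_wedge P _ _ _ _ _ satP.
have wedgeT := no_wedge _ _ _ _ _ _ (saturatedT P satP).
rewrite /transpose in wedgeT.
have Sl : (exists e1 : int, (e1 = 1 \/ e1 = -1) /\ P (x - 2) (y + e1)) \/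
          (y = a - e \/ P (x + 2) (a - e)).
  have [] : (P (x - 1 + -1) (y + 1) \/ P (x - 1 + -1) (y - 1)) \/
    (P (x + 1 + 1) (a + - e) \/ P (x + 1 - 1) (a + - e)).
  - apply: sat_sep_step Pl _ _ => //; [by right|lia|..].
      by apply: rel_eq P0 _ _; lia.
    by apply: rel_eq Pr _ _; lia.
  - by case=> Q; left; [exists 1 | exists (-1)]; split; auto;
      apply: rel_eq Q _ _; lia.
  - case=> Q; right; last by left; have := rook _ _ _ _ Q P0; lia.
    by right; apply: rel_eq Q _ _; lia.
have Sr : (exists e2 : int, (e2 = 1 \/ e2 = -1) /\ P (x + 2) (y + e2)) \/
          (y = a + 2 * e \/ P (x - 2) (a + 2 * e)).
  have [] : (P (x + 1 + 1) (y + 1) \/ P (x + 1 + 1) (y - 1)) \/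
    (P (x - 1 + 1) (a + e + e) \/ P (x - 1 - 1) (a + e + e)).
  - apply: sat_sep_step Pr _ _ => //; first by left.
      by apply: rel_eq P0 _ _; lia.
    by apply: rel_eq Pl _ _; lia.
  - by case=> Q; left; [exists 1 | exists (-1)]; split; auto;
      apply: rel_eq Q _ _; lia.
  - case=> Q; right; first by left; have := rook _ _ _ _ Q P0; lia.
    by right; apply: rel_eq Q _ _; lia.
have y_a : y <> a by have := rook _ _ _ _ P0 Pl; lia.
have y_ae : y <> a + e by have := rook _ _ _ _ P0 Pr; lia.
case: Sl Sr => [[e1 [e1E Q1]]|[yE|Q1]] [[e2 [e2E Q2]]|[yE2|Q2]].
(* Five consecutive columns: [e1 = e] gives a wedge to the right or to the left, depending on the
   side of [y], and [e1 = - e] gives a chain. *)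
- exfalso; have ? : e2 = - e1 by have := rook _ _ _ _ Q1 Q2; lia.
  subst e2; have [?|?] : e1 = e \/ e1 = - e by lia.
    subst e1; have [aby|aby] : 0 < e * (a - y) \/ 0 < - e * (a + e - y).
    + by case: eE => ?; subst e; lia.
    + apply: (wedge (x - 1) a y 1 e) => //; first by left.
      * by apply: rel_eq P0 _ _; lia.
      * by apply: rel_eq Pr _ _; lia.
      * by apply: rel_eq Q2 _ _; lia.
    + apply: (wedge (x + 1) (a + e) y (-1) (- e)) => //; first by right.
      * by apply: rel_eq P0 _ _; lia.
      * by apply: rel_eq Pl _ _; lia.
      * by apply: rel_eq Q1 _ _; lia.
  subst e1; apply: (no_chain P (x - 2) a (y - e) e satP eE).
  + by apply: rel_eq Q1 _ _; lia.
  + by apply: rel_eq Pl _ _; lia.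
  + by apply: rel_eq P0 _ _; lia.
  + by apply: rel_eq Pr _ _; lia.
  + by apply: rel_eq Q2 _ _; lia.
- exfalso; have ? : y + e1 = a + 3 * e by have := rook _ _ _ _ Q1 Pr; lia.
  apply: (wedge (x + 1) (a + e) (a + 2 * e) (-1) (- e)) => //; first by right.
  + lia.
  + by case: eE => ?; subst e; lia.
  + by apply: rel_eq P0 _ _; lia.
  + by apply: rel_eq Pl _ _; lia.
  + by apply: rel_eq Q1 _ _; lia.
- have ? : y = a + 3 * e by have := rook _ _ _ _ Q1 Q2; lia.
  case: eE => ?; subst e y;
    [exists (x - 2), a, false | exists (x - 2), (a - 3), true];
    (split; last by right; lia); apply: box_intro; rewrite /pattern /=;
    [apply: rel_eq Q2 _ _ | apply: rel_eq Pl _ _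
    |apply: rel_eq P0 _ _ | apply: rel_eq Pr _ _
    |apply: rel_eq Q2 _ _ | apply: rel_eq Pl _ _
    |apply: rel_eq P0 _ _ | apply: rel_eq Pr _ _]; lia.
- exfalso; have ? : y + e2 = a - 2 * e by have := rook _ _ _ _ Q2 Pl; lia.
  apply: (wedge (x - 1) a y 1 e) => //; first by left.
  + by case: eE => ?; subst e; lia.
  + by apply: rel_eq P0 _ _; lia.
  + by apply: rel_eq Pr _ _; lia.
  + by apply: rel_eq Q2 _ _; lia.
- lia.
- exfalso; apply: (wedgeT (a - e) x (x - 1) e 1) => //; first by left.
  + lia.
  + by apply: rel_eq P0 _ _; lia.
  + by apply: rel_eq Pl _ _; lia.
  + by apply: rel_eq Pr _ _; lia.
  + by apply: rel_eq Q2 _ _; lia.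
- have ? : y = a - 2 * e.
    by have := rook _ _ _ _ Q1 Q2; have := rook _ _ _ _ Q1 Pl; lia.
  case: eE => ?; subst e y;
    [exists (x - 1), (a - 2), false | exists (x - 1), (a - 1), true];
    (split; last by left; lia); apply: box_intro; rewrite /pattern /=;
    [apply: rel_eq Pl _ _ | apply: rel_eq P0 _ _
    |apply: rel_eq Pr _ _ | apply: rel_eq Q1 _ _
    |apply: rel_eq Pl _ _ | apply: rel_eq P0 _ _
    |apply: rel_eq Pr _ _ | apply: rel_eq Q1 _ _]; lia.
- exfalso; apply: (wedgeT (a + 2 * e) x (x + 1) (- e) (-1)) => //; first lia.
  + by right.
  + lia.
  + by apply: rel_eq P0 _ _; lia.
  + by apply: rel_eq Pr _ _; lia.
  + by apply: rel_eq Pl _ _; lia.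
  + by apply: rel_eq Q1 _ _; lia.
(* Separating the outer point of column [x - 2] forces [y = a + 3 * e], and separating that of
   column [x + 2] forces [y = a - 2 * e]. *)
- exfalso; have ? : y = a + 3 * e.
    have [] : (P (x - 2 + -1) (a + 1) \/ P (x - 2 + -1) (a - 1)) \/
      (P (x + 1 + 1) (a + 2 * e + e) \/ P (x + 1 - 1) (a + 2 * e + e)).
    + apply: sat_sep_step Q2 _ _ => //; first by right.
        by apply: rel_eq Pl _ _; lia.
      by apply: rel_eq Pr _ _; lia.
    + by case=> Q; have := rook _ _ _ _ Q Q1; have := rook _ _ _ _ Q Pr; lia.
    + by case=> Q; [have := rook _ _ _ _ Q Q1 | have := rook _ _ _ _ Q P0]; lia.
  have [] : (P (x + 2 + 1) (a + e + 1) \/ P (x + 2 + 1) (a + e - 1)) \/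
    (P (x - 1 + 1) (a - e + - e) \/ P (x - 1 - 1) (a - e + - e)).
  + apply: sat_sep_step Q1 _ _ => //; [by left|lia|..].
      by apply: rel_eq Pr _ _; lia.
    by apply: rel_eq Pl _ _; lia.
  + by case=> Q; have := rook _ _ _ _ Q Q2; have := rook _ _ _ _ Q Pl; lia.
  + by case=> Q; [have := rook _ _ _ _ Q P0 | have := rook _ _ _ _ Q Q2]; lia.
Qed.

(** The patterns 2413 and 3142 are inverse permutations. *)
Lemma boxT P p q b : box P p q b -> box (transpose P) q p (~~ b).
Proof.
move=> B t t4; have := B (pattern (~~ b) t).
by case: b {B}; case: t t4 => [|[|[|[|t]]]] //= _; apply.
Qed.

Lemma saturated_box P x y : saturated P -> P x y ->
  exists p q b t, [/\ box P p q b, (t < 4)%N & x = p + t%:Z].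
Proof.
move=> satP Pxy; case: (sat_sep P satP x y Pxy) => [|sep].
  case/(col_sep_box P x y satP Pxy) => p [q [b [B xE]]].
  by case: xE => ->; exists p, q, b; [exists 1%N | exists 2%N].
have [q [p [b [B yE]]]] := col_sep_box _ _ _ (saturatedT P satP) Pxy sep.
have {}B : box P p q (~~ b) by apply: boxT B.
have rook := sat_rook P satP.
have [t t4 yt] : exists2 t, (t < 4)%N & y = q + (pattern (~~ b) t)%:Z.
  case: yE => ->; first by exists (pattern b 1); case: b {B}.
  by exists (pattern b 2); case: b {B}.
exists p, q, (~~ b), t; split=> //.
by apply/(rook _ _ _ _ Pxy (B t t4)).
Qed.

(** * The tiling by boxes *)

Lemma box_overlap P p q b p' q' b' t t' : saturated P ->
  box P p q b -> box P p' q' b' -> (t < 4)%N -> (t' < 4)%N ->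
  p + t%:Z = p' + t'%:Z -> p = p'.
Proof.
move=> satP; have rook := sat_rook P satP.
wlog lepp : p q b p' q' b' t t' / p <= p'.
  move=> th B B' t4 t'4 tt; have [pp|pp] : p <= p' \/ p' <= p by lia.
    exact: (th _ _ _ _ _ _ _ _ pp B B' t4 t'4 tt).
  by apply/esym; apply: (th _ _ _ _ _ _ _ _ pp B' B t'4 t4); lia.
move=> B B' t4 t'4 tt.
have [//|[d [dE pE]]] : p = p' \/
  exists d, (d = 1 \/ d = 2 \/ d = 3)%N /\ p' = p + d%:Z.
  have [?|[d3 d0]] : p = p' \/ (absz (p' - p)%R < 4)%N /\ p <> p' by lia.
    by left.
  by right; exists (absz (p' - p)%R); lia.
subst p'; clear tt.
exfalso; move: (B 0 isT) (B 1 isT) (B 2 isT) (B 3 isT)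
  (B' 0 isT) (B' 1 isT) (B' 2 isT) (B' 3 isT) => {B B'}.
rewrite /pattern; case: b; case: b' => /= B0 B1 B2 B3 B'0 B'1 B'2 B'3.
(* For shift 1 the three shared columns have incompatible row differences. For shifts 2 and 3 the
   shared columns either disagree or fix [q' - q], and then some row holds two points. *)
all: case: dE => [?|[?|?]]; subst d.
all: first
  [ by have := rook _ _ _ _ B1 B'0; have := rook _ _ _ _ B2 B'1;
       have := rook _ _ _ _ B3 B'2; lia
  | by have := rook _ _ _ _ B2 B'0; have := rook _ _ _ _ B3 B'1;
       have := rook _ _ _ _ B0 B'3; lia
  | have := rook _ _ _ _ B3 B'0; have := rook _ _ _ _ B1 B'1;
    have := rook _ _ _ _ B1 B'2;
    have := rook _ _ _ _ B1 B'3; have := rook _ _ _ _ B0 B'2;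
    have := rook _ _ _ _ B0 B'3;
    have := rook _ _ _ _ B2 B'2; lia ].
Qed.

Definition initial (P : int -> int -> Prop) : Prop :=
  forall x y, P x y -> 0 <= x /\
    forall m : nat, m%:Z <= x -> exists z, P m%:Z z.

Lemma initial_box P (i : nat) y : saturated P -> initial P ->
  P (4 * i)%:Z y -> exists q b, box P (4 * i)%:Z q b.
Proof.
move=> satP iniP; elim: i y => [|i IHi] y Py;
  have [p [q [b [t [B t4 xE]]]]] := saturated_box P _ _ satP Py.
  by exists q, b; suff <- : p = (4 * 0)%:Z by [];
    have [] := iniP _ _ (B 0 isT); lia.
have [_ /(_ (4 * i)%N) []] := iniP _ _ Py; first lia.
move=> z /IHi [q' [b' B']].
(* A box meeting column 4(i+1) but opening earlier would contain column 4i+3, the last one of the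
   preceding box. *)
case: t t4 xE => [|t] t4 xE.
  by exists q, b; suff <- : p = (4 * i.+1)%:Z by []; lia.
have := box_overlap _ _ _ _ _ _ _ t 3 satP B B'; lia.
Qed.

Lemma box_aligned P p q b : saturated P -> initial P -> box P p q b ->
  exists i : nat, p = (4 * i)%:Z.
Proof.
move=> satP iniP B; have [p0 below] := iniP _ _ (B 0 isT).
pose m := absz p; exists (m %/ 4)%N.
have [|z Pz] := below (4 * (m %/ 4))%N; first by lia.
have [q' [b' B']] := initial_box P _ _ satP iniP Pz.
by apply: (box_overlap _ _ _ _ _ _ _ 0 (m %% 4) satP B B') => //; lia.
Qed.

Lemma tiling P (i : nat) y :
  saturated P -> initial P -> initial (transpose P) ->
  P (4 * i)%:Z y -> exists (j : nat) b, box P (4 * i)%:Z (4 * j)%:Z b.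
Proof.
move=> satP iniP iniT Py; have [q [b B]] := initial_box P i y satP iniP Py.
have [j qE] := box_aligned _ _ _ _ (saturatedT P satP) iniT (boxT _ _ _ _ B).
by exists j, b; rewrite -qE.
Qed.

(** * From permutations to point sets *)

Definition graph {n} (s : 'S_n) (x y : int) : Prop :=
  exists i : 'I_n, x = i%:Z /\ y = (s i)%:Z.

Lemma graphV n (s : 'S_n) x y : graph (s^-1)%g x y <-> transpose (graph s) x y.
Proof.
split=> -[i [-> ->]]; [exists ((s^-1)%g i) | exists (s i)];
  by rewrite ?permKV ?permK.
Qed.

Lemma graph_col_sep n (s : 'S_n) (i : nat) :
  col_sep (graph s) i%:Z <->
  [exists b : 'I_n, exists c : 'I_n,
    [&& b.+1 == i, c == i.+1 :> nat & `|s b - s c|%N == 1%N]].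
Proof.
split.
  case=> z [e [eE [b [bE zE]] [c [cE zeE]]]].
  by apply/existsP; exists b; apply/existsP; exists c; lia.
case/existsP => b /existsP [c /and3P [/eqP bi /eqP ci d1]].
exists (s b)%:Z, ((s c)%:Z - (s b)%:Z); split;
  [lia | exists b; lia | exists c; lia].
Qed.

Lemma saturated_graph n (s : 'S_n) :
  (forall i : 'I_n,
     col_sep (graph s) i%:Z \/ col_sep (transpose (graph s)) (s i)%:Z) ->
  saturated (graph s).
Proof.
move=> sep; split=> [x y x' y' [i [-> ->]] [i' [-> ->]]||x y [i [-> ->]] //].
- by split=> [[/val_inj ->] //|[/val_inj /perm_inj ->] //].
- by exists n%:Z => x y [i [-> ->]]; have := ltn_ord i;
    have := ltn_ord (s i); lia.
Qed.

Lemma graph_saturated n (s : 'S_n) :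
  saturated (graph s) <-> #|separators s| = n.
Proof.
have col_sepV (i : nat) :
    col_sep (transpose (graph s)) i%:Z <-> col_sep (graph (s^-1)%g) i%:Z.
  by split=> -[z [e [eE Q1 Q2]]]; exists z, e; split=> //; apply/graphV.
have vertE (a : 'I_n) :
    col_sep (graph s) ((s^-1)%g a)%:Z <-> vertical_separator s a.
  rewrite graph_col_sep; split.
    case/existsP => b /existsP [c /and3P [bE cE d1]].
    apply/existsP; exists b; apply/existsP; exists ((s^-1)%g a).
    by apply/existsP; exists c; rewrite permKV eqxx bE cE.
  case/existsP => b /existsP [j /existsP [c /and4P [/eqP <- bE cE d1]]].
  rewrite permK; apply/existsP; exists b; apply/existsP; exists c.
  by rewrite bE cE.
have horE (a : 'I_n) :
    col_sep (transpose (graph s)) a%:Z <-> horizontal_separator s a.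
  by rewrite col_sepV graph_col_sep.
split=> [satP|sepn].
  rewrite -[RHS]card_ord -cardsT; apply: eq_card => a; rewrite !inE.
  apply/orP; have [|/vertE|/horE] := sat_sep _ satP ((s^-1)%g a)%:Z a%:Z; auto.
  by exists ((s^-1)%g a); rewrite permKV.
apply: saturated_graph => i; have : s i \in separators s.
  suff -> : separators s = setT by [].
  by apply/eqP; rewrite eqEcard subsetT cardsT card_ord sepn leqnn.
rewrite inE => /orP[/vertE|/horE]; last by right.
by rewrite permK; left.
Qed.

Lemma graph_initial n (s : 'S_n) : initial (graph s).
Proof.
move=> x y [i [-> _]]; split=> // m mi.
have mn : (m < n)%N by have := ltn_ord i; lia.
by exists (s (Ordinal mn)); exists (Ordinal mn).
Qed.

Lemma graphT_initial n (s : 'S_n) : initial (transpose (graph s)).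
Proof.
move=> x y /graphV /graph_initial [x0 below]; split=> // m /below [z].
by move=> /graphV; exists z.
Qed.

(** The two inner columns of a box are separated by columns; the points of the two outer columns lie
    in its inner rows, so [boxT] applies. *)
Lemma box_sep P p q b t : box P p q b -> (t < 4)%N ->
  col_sep P (p + t%:Z) \/ col_sep (transpose P) (q + (pattern b t)%:Z).
Proof.
have inner Q u v c r : box Q u v c -> (r == 1)%N || (r == 2)%N ->
    col_sep Q (u + r%:Z).
  move=> B rE; exists (v + (pattern c r.-1)%:Z).
  exists ((pattern c r.+1)%:Z - (pattern c r.-1)%:Z).
  split; [|apply: rel_eq (B r.-1 _) _ _; lia|apply: rel_eq (B r.+1 _) _ _; lia].
  by case/orP: rE => /eqP ->; case: c {B}; [right|left|right|left].
move=> B t4; have [t12|t12] := boolP ((t == 1) || (t == 2))%N.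
  by left; apply: inner B t12.
right; apply: inner (boxT _ _ _ _ B) _.
by case: b t t4 t12 {B} => -[|[|[|[|t]]]].
Qed.

(** * Inflations of block permutations and their count *)

Section Inflation.
Local Open Scope nat_scope.

Lemma pattern_lt4 b t : pattern b t < 4.
Proof. by case: b; case: t => [|[|[|[|[|t]]]]]. Qed.

Lemma pattern_inj b t t' : t < 4 -> t' < 4 ->
  pattern b t = pattern b t' -> t = t'.
Proof. by case: b; case: t t' => [|[|[|[|t]]]] [|[|[|[|t']]]]. Qed.

Lemma quarter_subproof k (x : 'I_(4 * k)) : x %/ 4 < k.
Proof. by have := ltn_ord x; lia. Qed.

Definition quarter {k} (x : 'I_(4 * k)) : 'I_k :=
  Ordinal (quarter_subproof k x).

Lemma inflate_subproof k (p : 'S_k) (e : {ffun 'I_k -> bool}) (x : 'I_(4 * k)) :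
  4 * p (quarter x) + pattern (e (quarter x)) (x %% 4) < 4 * k.
Proof.
have := ltn_ord (p (quarter x)).
by have := pattern_lt4 (e (quarter x)) (x %% 4); lia.
Qed.

Definition inflate_fun {k} (pe : 'S_k * {ffun 'I_k -> bool}) (x : 'I_(4 * k)) :=
  Ordinal (inflate_subproof k pe.1 pe.2 x).

Lemma inflate_fun_inj k (pe : 'S_k * {ffun 'I_k -> bool}) :
  injective (inflate_fun pe).
Proof.
case: pe => p e x y /(congr1 val) /= xy.
have bx := pattern_lt4 (e (quarter x)) (x %% 4).
have bY := pattern_lt4 (e (quarter y)) (y %% 4).
have /val_inj/perm_inj qE : p (quarter x) = p (quarter y) :> nat by lia.
have qxy : x %/ 4 = y %/ 4 by move/(congr1 val): qE.
rewrite qE in xy.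
have : x %% 4 = y %% 4 by apply: (pattern_inj (e (quarter y))); lia.
by move=> rE; apply: val_inj => /=; lia.
Qed.

Definition inflate {k} (pe : 'S_k * {ffun 'I_k -> bool}) : 'S_(4 * k) :=
  perm (inflate_fun_inj k pe).

Lemma inflate_inj k : injective (@inflate k).
Proof.
move=> [p e] [p' e'] eq_pe.
have pe_i (i : 'I_k) : p i = p' i /\ e i = e' i.
  (* The first column of a block suffices: its row is 1 or 2 modulo 4 according to the pattern, and
     its quotient by 4 is the block row. *)
  have i4 : 4 * i < 4 * k by have := ltn_ord i; lia.
  have qi : quarter (Ordinal i4) = i by apply: val_inj => /=; lia.
  have := congr1 (fun s : 'S_(4 * k) => val (s (Ordinal i4))) eq_pe.
  rewrite !permE /= qi (_ : (4 * i) %% 4 = 0); last by lia.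
  rewrite /pattern; case: (e i); case: (e' i) => /= E;
    (split; [apply: val_inj => /=|]); lia.
congr pair; first by apply/permP => i; case: (pe_i i).
by apply/ffunP => i; case: (pe_i i).
Qed.

Lemma inflate_saturated k (pe : 'S_k * {ffun 'I_k -> bool}) :
  saturated (graph (inflate pe)).
Proof.
apply: saturated_graph => x.
have B : box (graph (inflate pe)) (4 * quarter x)%:Z
    (4 * pe.1 (quarter x))%:Z (pe.2 (quarter x)).
  move=> t t4; have yk : 4 * quarter x + t < 4 * k.
    by have := ltn_ord (quarter x); lia.
  have qy : quarter (Ordinal yk) = quarter x by apply: val_inj => /=; lia.
  exists (Ordinal yk); rewrite permE /= qy.
  by have -> : (4 * (x %/ 4) + t) %% 4 = t by lia.
have := box_sep _ _ _ _ (x %% 4) B; rewrite permE /= => sepx.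
by case: sepx => [|sepx|sepx]; [lia|left|right];
  apply: (eq_ind _ (col_sep _) sepx); lia.
Qed.

Lemma saturated_inflate k (s : 'S_(4 * k)) : saturated (graph s) ->
  exists pe, s = inflate pe.
Proof.
move=> satP.
have tile (i : 'I_k) : exists jb : 'I_k * bool, forall x : 'I_(4 * k),
    quarter x = i -> s x = 4 * jb.1 + pattern jb.2 (x %% 4) :> nat.
  have i4 : 4 * i < 4 * k by have := ltn_ord i; lia.
  have [|j [b B]] := tiling _ i (s (Ordinal i4))%:Z satP
    (graph_initial _ s) (graphT_initial _ s); first by exists (Ordinal i4).
  have jk : j < k by case: (B 0 isT) => y [_]; have := ltn_ord (s y); lia.
  exists (Ordinal jk, b) => x /(congr1 val) /= xi.
  have [|y [xy sy]] := B (x %% 4); first by lia.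
  have ? : x = y by apply: val_inj => /=; lia.
  by subst y; rewrite /=; lia.
have [jb jbE] := fin_all_exists tile.
have jb_inj : injective (fun i => (jb i).1).
  move=> i i' /(congr1 val) /= ii'.
  have col4 (l : 'I_k) : exists2 x : 'I_(4 * k),
      quarter x = l & s x = 4 * (jb l).1 :> nat.
    (* The offset at which the pattern takes the value 0: two blocks with the same block row would
       share their bottom row. *)
    pose t := if (jb l).2 then 2 else 1.
    have xk : 4 * l + t < 4 * k.
      by have := ltn_ord l; rewrite /t; case: ifP; lia.
    have xl : quarter (Ordinal xk) = l.
      by apply: val_inj => /=; rewrite /t; case: ifP; lia.
    exists (Ordinal xk) => //; rewrite (jbE _ _ xl) /= /t.
    have -> : (4 * l + t) %% 4 = t by rewrite /t; case: ifP; lia.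
    by rewrite /t; case: ((jb l).2) => /=; rewrite addn0.
  have [x qx sx] := col4 i; have [y qy sy] := col4 i'.
  rewrite -qx -qy; congr quarter; apply/(@perm_inj _ s)/val_inj.
  by rewrite /= sx sy ii'.
exists (perm jb_inj, [ffun i => (jb i).2]); apply/permP => x.
by apply: val_inj; rewrite !permE /= !permE ffunE; apply: jbE.
Qed.
End Inflation.

Theorem theorem2p7 (n : nat) (hn : (1 <= n)%N) :
  (forall k : nat, (0 < k)%N -> n = (4 * k)%N ->
     #|[set s : 'S_n | #|separators s| == n]| = (2 ^ k * k`!)%N)
  /\
  ((~ exists k : nat, (0 < k)%N /\ n = (4 * k)%N) ->
     #|[set s : 'S_n | #|separators s| == n]| = 0%N).
Proof.
split=> [k _ ->{n hn}|n4].
  have -> : [set s : 'S_(4 * k) | #|separators s| == (4 * k)%N] =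
            [set inflate pe | pe in [set: 'S_k * {ffun 'I_k -> bool}]].
    apply/setP => s; rewrite inE; apply/eqP/imsetP.
      by move=> /graph_saturated /saturated_inflate [pe ->]; exists pe.
    by case=> pe _ ->; apply/graph_saturated/inflate_saturated.
  rewrite (card_imset _ (@inflate_inj k)) cardsT card_prod card_ffun card_bool.
  by rewrite card_ord card_Sn mulnC.
apply/eqP; rewrite cards_eq0; apply/eqP/setP => s; rewrite !inE.
apply/negbTE/eqP => /graph_saturated satP; apply: n4.
(* The box opening at the largest multiple of 4 below [n] must have its fourth column below [n]
   too. *)
have i4 : (4 * (n.-1 %/ 4) < n)%N by lia.
have [|j [b B]] := tiling _ (n.-1 %/ 4) (s (Ordinal i4))%:Z satP
  (graph_initial _ s) (graphT_initial _ s); first by exists (Ordinal i4).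
exists (n.-1 %/ 4).+1; split=> //.
by case: (B 3%N isT) => y [yE _]; have := ltn_ord y; lia.
Qed.
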